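(* Let $A$ be a non-zero positive bounded operator on a complex Hilbert space $\mathscr{H}$ and let $B,C\in\mathbb{B}_A(\mathscr{H})$. Then for every non-zero scalar $\alpha\in\mathbb{C}$, $$w_{A,e}^2(B,C)\le\frac{\max\{1,|1-\alpha|\}\,\|(B,C)\|_{A,e}\,\|(B^\sharp,C^\sharp)\|_{A,e}+w_A(B^2)+w_A(C^2)}{|\alpha|}.$$
   Context: $\mathbb{B}(\mathscr{H})$ is the algebra of bounded linear operators on $\mathscr{H}$. For $x,y\in\mathscr{H}$, $\langle x,y\rangle_A=\langle Ax,y\rangle$ and $\|x\|_A=\langle Ax,x\rangle^{1/2}$. $\mathbb{B}_A(\mathscr{H})$ is the set of $T\in\mathbb{B}(\mathscr{H})$ for which there is $S\in\mathbb{B}(\mathscr{H})$ with $AS=T^*A$. For $T\in\mathbb{B}_A(\mathscr{H})$, $T^\sharp$ is the unique solution $X\in\mathbb{B}(\mathscr{H})$ of $AX=T^*A$ whose range is contained in $\overline{\mathcal{R}(A)}$. The $A$-numerical radius is $w_A(T)=\sup\{|\langle Tx,x\rangle_A|:\|x\|_A=1\}$. For a pair of operators, the $A$-Euclidean operator radius is $w_{A,e}(S,T)=\sup\{(|\langle Sx,x\rangle_A|^2+|\langle Tx,x\rangle_A|^2)^{1/2}: \|x\|_A=1\}$ and the $A$-Euclidean operator seminorm is $\|(S,T)\|_{A,e}=\sup\{(\|Sx\|_A^2+\|Tx\|_A^2)^{1/2}:\|x\|_A=1\}$; $w_{A,e}^2(B,C)$ means $(w_{A,e}(B,C))^2$.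 *)

(* Defs.v *)
From mathcomp Require Import all_boot all_order all_algebra complex.
From mathcomp Require Import all_classical all_reals all_analysis.

Set Implicit Arguments.
Unset Strict Implicit.
Unset Printing Implicit Defensive.

Import Order.TTheory GRing.Theory Num.Theory.

Local Open Scope classical_set_scope.
Local Open Scope complex_scope.
Local Open Scope ring_scope.

(* Inner products are linear in their first argument and conjugate-linear in
   the second; [hilbert_ip] says that [ip] induces the complete norm of [H]. *)
Notation inner_product H := {dot H for @Num.conj _}.

Definition hilbert_ip (R : realType) (H : completeNormedModType R[i])
    (ip : inner_product H) : Prop :=
  forall x : H, `|x| ^+ 2 = ip x x.

Section Operators.
Variables (R : realType) (H : completeNormedModType R[i]).
Variable ip : inner_product H.

Implicit Types (A S T X : H -> H) (x y : H).

Definition bounded_operator T : Prop :=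
  linear T /\ exists M : R, forall x, `|T x| <= M%:C * `|x|.

(* The order of R[i] makes [0 <= z] assert that z is real and nonnegative. *)
Definition positive_operator A : Prop := forall x, 0 <= ip (A x) x.

(* The (unique) Hilbert space adjoint T^*. *)
Definition adjoint T : H -> H :=
  get [set S | bounded_operator S /\ forall x y, ip (T x) y = ip x (S y)].

Definition A_adjointable A T : Prop :=
  bounded_operator T /\
  exists S, bounded_operator S /\ A \o S = adjoint T \o A.

(* The (unique) reduced A-adjoint. *)
Definition sharp A T : H -> H :=
  get [set X | [/\ bounded_operator X, A \o X = adjoint T \o A
                 & range X `<=` closure (range A)]].

Definition ipA A x y : R[i] := ip (A x) y.

Definition normA A x : R := Num.sqrt (complex.Re (ipA A x x)).

Definition A_sphere A : set H := [set x | normA A x = 1].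

(* [Normc.normc] is the R-valued modulus: `|z| = (Normc.normc z)%:C in R[i].
   All suprema below are taken in R; for operators in [A_adjointable A] and
   A positive and nonzero they range over nonempty bounded sets. *)
Definition w_A A T : R :=
  sup [set Normc.normc (ipA A (T x) x) | x in A_sphere A].

Definition w_Ae A S T : R :=
  sup [set Num.sqrt (Normc.normc (ipA A (S x) x) ^+ 2
                     + Normc.normc (ipA A (T x) x) ^+ 2)
      | x in A_sphere A].

Definition norm_Ae A S T : R :=
  sup [set Num.sqrt (normA A (S x) ^+ 2 + normA A (T x) ^+ 2)
      | x in A_sphere A].

End Operators.

(* Main.v *)
(* Since [A T^# = T^* A], taking [x = T e] and [y = T^# e] in Buzano's inequality
   [|alpha| |<x,e> <e,y>| <= max(1,|1-alpha|) |x| |y| + |<x,y>|] for the semi-inner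
   product [<.,.>_A] gives
   [|alpha| |<T e,e>|^2 <= max(1,|1-alpha|) |T e| |T^# e| + |<T^2 e,e>|];
   add the cases [T = B] and [T = C], apply Cauchy-Schwarz in the plane and take
   suprema.  The suprema are finite because, for an [A]-adjoint pair [T], [S], the
   operator [K = S T] is symmetric for [<.,.>_A], so that [|K x|_A^(2^k) <=
   |K^(2^k) x|_A] on the [A]-unit sphere and [|K x|_A] is at most the growth rate
   of the iterates of [K]. *)
Require Import Defs.
From mathcomp Require Import all_boot all_order all_algebra complex.
From mathcomp Require Import all_classical all_reals all_analysis.
From mathcomp Require Import ring lra.

Set Implicit Arguments.
Unset Strict Implicit.
Unset Printing Implicit Defensive.

Import Order.TTheory GRing.Theory Num.Theory.

Local Open Scope classical_set_scope.
Local Open Scope complex_scope.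
Local Open Scope ring_scope.

(** * The real-valued modulus and a discriminant bound *)

Section ComplexModulus.
Variable R : realType.
Implicit Types z w : R[i].

Lemma normc_ge0 z : 0 <= Normc.normc z.
Proof. by case: z => a b /=; exact: sqrtr_ge0. Qed.

Lemma sqr_normcE z : Normc.normc z ^+ 2 = complex.Re z ^+ 2 + complex.Im z ^+ 2.
Proof. by case: z => a b /=; rewrite sqr_sqrtr// addr_ge0// sqr_ge0. Qed.

Lemma normc_real (r : R) : 0 <= r -> Normc.normc r%:C = r.
Proof. by move=> r0 /=; rewrite expr0n/= addr0 sqrtr_sqr ger0_norm. Qed.

Lemma normc_gt0 z : z != 0 -> 0 < Normc.normc z.
Proof.
move=> z0; rewrite lt_neqAle normc_ge0 andbT eq_sym.
by apply: contra z0 => /eqP/Normc.eq0_normc ->.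
Qed.

(** Along [a = - t z] the hypothesis is a real quadratic in [t], with minimum at [t = 1 / q] when
    [q > 0]. Keeping [d] free covers Cauchy-Schwarz as well as estimates at an approximate
    minimizer. *)
Lemma sqr_normc_le_discriminant (d q : R) z : 0 <= q ->
  (forall a : R[i], 0 <= d + 2 * complex.Re (conjc a * z) + Normc.normc a ^+ 2 * q) ->
  Normc.normc z ^+ 2 <= d * q.
Proof.
move=> q0 h; set N := Normc.normc z ^+ 2.
have hN (t : R) : 0 <= d - 2 * t * N + t ^+ 2 * N * q.
  move: (h ((- t)%:C * z)); rewrite sqr_normcE /N sqr_normcE.
  case: z {h N} => u v /= h.
  by apply: le_trans h _; rewrite le_eqVlt; apply/orP; left; apply/eqP; ring.
have N0 : 0 <= N by exact: sqr_ge0.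
have d0 : 0 <= d by have := hN 0; lra.
have [q_gt0|q_le0] := ltP 0 q.
  rewrite -ler_pdivrMr//; have := hN q^-1.
  have -> : q^-1 ^+ 2 * N * q = N / q by field; rewrite gt_eqF.
  by rewrite [2 * q^-1 * N](_ : _ = 2 * (N / q)); [lra|ring].
have {q_le0}q0E : q = 0 by apply/eqP; rewrite eq_le q_le0 q0.
rewrite q0E mulr0; have [//|N_gt0] := leP N 0.
(* With [q = 0] the quadratic is affine in [t]; at this [t] it equals [- d - 2 < 0]. *)
have := hN (d / N + N^-1); rewrite q0E mulr0 addr0.
by rewrite [X in d - X](_ : _ = 2 * d + 2); [lra|field; rewrite gt_eqF].
Qed.

End ComplexModulus.

(** * Cauchy-Schwarz and Buzano inequalities for semi-inner products *)

Section SemiInnerProduct.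
Variables (R : realType) (V : lmodType R[i]).

(** Degenerate forms are allowed, so that [ip] and [ipA ip A] are treated together. *)
Definition semi_inner_product (f : V -> V -> R[i]) : Prop :=
  [/\ forall a x y z, f (a *: x + y) z = a * f x z + f y z,
      forall x y, f y x = conjc (f x y)
    & forall x, 0 <= f x x].

Definition seminorm (f : V -> V -> R[i]) (x : V) : R := Num.sqrt (complex.Re (f x x)).

Variable f : V -> V -> R[i].
Hypothesis hf : semi_inner_product f.
Implicit Types (x y z e : V) (T S : V -> V).
Local Notation "`[ x ]" := (seminorm f x).

Lemma sipPl a x y z : f (a *: x + y) z = a * f x z + f y z.
Proof. by case: hf. Qed.

Lemma sip_conj x y : f y x = conjc (f x y).
Proof. by case: hf. Qed.

Lemma sip0l x : f 0 x = 0.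
Proof.
have /eqP := sipPl 1 0 0 x; rewrite scaler0 addr0 mul1r.
by rewrite -subr_eq subrr eq_sym => /eqP.
Qed.

Lemma sip0r x : f x 0 = 0.
Proof. by rewrite sip_conj sip0l conjc0. Qed.

Lemma sipPr a x y z : f z (a *: x + y) = conjc a * f z x + f z y.
Proof. by rewrite sip_conj sipPl rmorphD rmorphM/= -!sip_conj. Qed.

Lemma sipBl x y z : f (x - y) z = f x z - f y z.
Proof. by rewrite addrC -scaleN1r sipPl mulN1r addrC. Qed.

Lemma sipBr x y z : f z (x - y) = f z x - f z y.
Proof. by rewrite sip_conj sipBl rmorphB/= -!sip_conj. Qed.

Lemma seminorm_ge0 x : 0 <= `[x].
Proof. exact: sqrtr_ge0. Qed.

Lemma sqr_seminormC x : (`[x] ^+ 2)%:C = f x x.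
Proof.
case: hf => _ _ /(_ x); rewrite /seminorm; case: (f x x) => a b.
by rewrite lecE/= => /andP[/eqP -> a0]; rewrite sqr_sqrtr.
Qed.

Lemma sqr_seminorm x : `[x] ^+ 2 = complex.Re (f x x).
Proof. by rewrite -sqr_seminormC. Qed.

Lemma sqr_seminormD a x y :
  `[a *: x + y] ^+ 2
  = `[y] ^+ 2 + 2 * complex.Re (conjc a * f y x) + Normc.normc a ^+ 2 * `[x] ^+ 2.
Proof.
rewrite sqr_seminorm sipPl !sipPr sqr_normcE -(sqr_seminormC x) -(sqr_seminormC y).
rewrite (sip_conj y x); case: (f y x) => u v; case: a => a b /=; ring.
Qed.

Lemma seminorm_sip_le x y : Normc.normc (f x y) <= `[x] * `[y].
Proof.
rewrite -[_ <= _](@ler_pXn2r _ 2)// ?nnegrE ?mulr_ge0 ?seminorm_ge0 ?normc_ge0//.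
rewrite exprMn; apply: sqr_normc_le_discriminant; first exact: sqr_ge0.
by move=> a; rewrite -sqr_seminormD sqr_ge0.
Qed.

(* The vector [alpha <x, e> e - x] has seminorm at most [max 1 |1 - alpha|]
   times that of [x]; Cauchy-Schwarz against [y] then gives the claim. *)
Lemma buzano_le (alpha : R[i]) x y e : `[e] = 1 ->
  Normc.normc alpha * Normc.normc (f x e * f e y)
  <= Num.max 1 (Normc.normc (1 - alpha)) * `[x] * `[y] + Normc.normc (f x y).
Proof.
move=> e1; set m := Num.max _ _; set p := f x e.
have m1 : 1 <= m by rewrite le_max lexx.
have m0 : 0 <= m by apply: le_trans m1.
have hw : `[(- (alpha * p)) *: e + x] <= m * `[x].
  rewrite -[_ <= _](@ler_pXn2r _ 2)// ?nnegrE ?mulr_ge0 ?seminorm_ge0//.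
  rewrite sqr_seminormD e1 expr1n mulr1 -/p exprMn.
  have pN : Normc.normc p ^+ 2 <= `[x] ^+ 2.
    rewrite ler_pXn2r// ?nnegrE ?seminorm_ge0 ?normc_ge0//.
    by apply: le_trans (seminorm_sip_le _ _) _; rewrite e1 mulr1.
  (* Expansion uses [|e| = 1]. Since [|p|^2] lies between 0 and [|x|^2], the value lies between
     [|x|^2] and [|1 - alpha|^2 |x|^2]. *)
  rewrite [X in X <= _](_ : _ = `[x] ^+ 2
      + (Normc.normc (1 - alpha) ^+ 2 - 1) * Normc.normc p ^+ 2); last first.
    rewrite !sqr_normcE; case: (p) => u v; case: (alpha) => a b /=; ring.
  have mA : Normc.normc (1 - alpha) ^+ 2 <= m ^+ 2.
    by rewrite ler_pXn2r// ?nnegrE ?normc_ge0// le_max lexx orbT.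
  have m2 : 1 <= m ^+ 2 by rewrite exprn_ege1.
  have := sqr_ge0 (Normc.normc p).
  move: pN mA m2; move: (Normc.normc p ^+ 2) (`[x] ^+ 2) (m ^+ 2) (Normc.normc _ ^+ 2).
  by move=> P X M N ? ? ? ?; nra.
rewrite -Normc.normcM.
have -> : alpha * (p * f e y) = f x y - f ((- (alpha * p)) *: e + x) y.
  by rewrite sipPl; ring.
apply: le_trans (le_normcD _ _) _; rewrite normcN addrC lerD2r.
by apply: le_trans (seminorm_sip_le _ _) _; rewrite ler_wpM2r ?seminorm_ge0.
Qed.

End SemiInnerProduct.

(** If [a > b], write [a / b = 1 + e]; Bernoulli gives [1 + 2^k e <= D] for all [k], against the
    Archimedean property. *)
Lemma le_of_expr_bounded (R : archiRealFieldType) (a b D : R) : 0 < b ->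
  (forall k, a ^+ (2 ^ k) <= D * b ^+ (2 ^ k)) -> a <= b.
Proof.
move=> b0 h; rewrite leNgt; apply/negP => ab.
set e := a / b - 1.
have e0 : 0 < e by rewrite subr_gt0 ltr_pdivlMr// mul1r.
have bern n : 1 + n%:R * e <= (a / b) ^+ n.
  have -> : a / b = 1 + e by rewrite addrC subrK.
  elim: n => [|n IH]; first by rewrite mul0r addr0 expr0.
  rewrite exprS; apply: le_trans (_ : (1 + e) * (1 + n%:R * e) <= _).
    have : 0 <= n%:R * e ^+ 2 by rewrite mulr_ge0// sqr_ge0.
    by rewrite -natr1; nra.
  by rewrite ler_wpM2l// addr_ge0// ltW.
have [k kD] : exists k : nat, D / e < k%:R.
  by exists (Num.bound `|D / e|); apply: le_lt_trans (ler_norm _) _; apply: archi_boundP.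
have : 1 + (2 ^ k)%:R * e <= D.
  by apply: le_trans (bern _) _; rewrite expr_div_n ler_pdivrMr ?exprn_gt0.
have : k%:R <= (2 ^ k)%:R :> R by rewrite ler_nat ltnW// ltn_expl.
by move: kD; rewrite ltr_pdivrMr//; nra.
Qed.

(** * Adjoint pairs for a semi-inner product *)

Section AdjointPairs.
Variables (R : realType) (V : lmodType R[i]) (f : V -> V -> R[i]).
Hypothesis hf : semi_inner_product f.
Implicit Types (x y z e : V) (T S K : V -> V).
Local Notation "`[ x ]" := (seminorm f x).

(* [|K^m x|^2 = <K^(2m) x, x>], so iterated squaring bounds [|K x|^(2^k)] by
   [|K^(2^k) x|], and the growth rate of the latter by [|K x|]. *)
Lemma symmetric_seminorm_le K x (b D : R) :
  (forall y z, f (K y) z = f y (K z)) -> 0 < b -> `[x] = 1 ->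
  (forall k, `[iter k K x] <= D * b ^+ k) -> `[K x] <= b.
Proof.
move=> sK b0 x1 hD; apply: (@le_of_expr_bounded _ _ _ D) => // k.
apply: le_trans (hD _); elim: k => [|k IH]; first by rewrite expn0 expr1.
rewrite expnSr exprM; apply: le_trans (_ : `[iter (2 ^ k) K x] ^+ 2 <= _).
  by rewrite ler_pXn2r// ?nnegrE ?exprn_ge0// seminorm_ge0.
have iterK m y z : f (iter m K y) z = f y (iter m K z).
  by elim: m y z => //= m IHm y z; rewrite sK IHm -iterSr.
rewrite -[leLHS]normc_real ?sqr_ge0// sqr_seminormC//.
rewrite -iterK -iterD addnn -muln2.
by apply: le_trans (seminorm_sip_le hf _ _) _; rewrite x1 mulr1.
Qed.

(** For [K = S \o T], which is symmetric, [|T x|^2 = <x, K x> <= |K x| <= b]. *)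
Lemma adjoint_seminorm_le T S x (b D : R) :
  (forall y z, f (T y) z = f y (S z)) -> 0 < b -> `[x] = 1 ->
  (forall k, `[iter k (S \o T) x] <= D * b ^+ k) -> `[T x] <= Num.sqrt b.
Proof.
move=> TS b0 x1 hD.
have ST y z : f (S y) z = f y (T z) by rewrite (sip_conj hf) -TS -(sip_conj hf).
have sK y z : f (S (T y)) z = f y (S (T z)) by rewrite ST TS.
have Kb := symmetric_seminorm_le sK b0 x1 hD.
rewrite -(ger0_norm (seminorm_ge0 f (T x))) -sqrtr_sqr ler_wsqrtr//.
rewrite -[leLHS]normc_real ?sqr_ge0// sqr_seminormC// TS.
by apply: le_trans (seminorm_sip_le hf _ _) _; rewrite x1 mul1r.
Qed.

Lemma buzano_adjoint_le (alpha : R[i]) T S e :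
  (forall y z, f (T y) z = f y (S z)) -> `[e] = 1 ->
  Normc.normc alpha * Normc.normc (f (T e) e) ^+ 2
  <= Num.max 1 (Normc.normc (1 - alpha)) * (`[T e] * `[S e])
     + Normc.normc (f (T (T e)) e).
Proof.
move=> TS e1; have := buzano_le hf alpha (T e) (S e) e1.
by rewrite -!TS Normc.normcM -expr2 -mulrA.
Qed.

End AdjointPairs.

Lemma le0_of_le_mul (R : realFieldType) (a c : R) : 0 <= c ->
  (forall e, 0 < e -> a <= c * e) -> a <= 0.
Proof.
move=> c0 h; apply/ler_addgt0Pr => e e0; rewrite add0r.
have c1 : 0 < c + 1 by rewrite ltr_wpDl.
(* Dividing by [c + 1] also covers [c = 0]. *)
apply: le_trans (h (e / (c + 1)) _) _; first by rewrite divr_gt0.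
by rewrite mulrCA ger_pMr// ler_pdivrMr// mul1r lerDl.
Qed.

(** * Orthogonal projection in a Hilbert space *)

Section HilbertSpace.
Variables (R : realType) (H : completeNormedModType R[i]) (ip : inner_product H).
Hypothesis hip : hilbert_ip ip.
Implicit Types (x y z m p : H) (M : set H) (T S : H -> H).
Local Notation "`[ x ]" := (seminorm ip x).

Lemma semi_inner_product_ip : semi_inner_product ip.
Proof.
split=> [a x y z|x y|x]; first exact: linearPl.
  by rewrite hermC expr0 mul1r.
by rewrite -hip exprn_ge0.
Qed.
Let hs := semi_inner_product_ip.

Lemma normE x : `|x| = `[x]%:C.
Proof.
apply/eqP; rewrite -(@eqrXn2 _ 2)// ?ler0c ?seminorm_ge0// hip -(sqr_seminormC hs).
by rewrite rmorphXn.
Qed.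

Lemma seminorm_eq0 x : `[x] = 0 -> x = 0.
Proof. by move=> x0; apply/eqP; rewrite -normr_eq0 normE x0. Qed.

Lemma bounded_operator_seminorm T : bounded_operator T ->
  exists2 K : R, 0 < K & forall x, `[T x] <= K * `[x].
Proof.
case=> _ [K TK]; exists (Num.max 1 K); first by rewrite lt_max ltr01.
move=> x; apply: le_trans (_ : K * `[x] <= _).
  by rewrite -lecR rmorphM/= -!normE.
by rewrite ler_wpM2r ?seminorm_ge0// le_max lexx orbT.
Qed.

Lemma operator0 T : linear T -> T 0 = 0.
Proof.
by move=> /(_ (-1) 0 0); rewrite scaler0 addr0 scaleN1r addNr.
Qed.

Lemma closure_seminorm M p (e : R) : closure M p -> 0 < e ->
  exists2 m, M m & `[p - m] < e.
Proof.
move=> clp e0; have eC : 0 < e%:C by rewrite ltcR.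
have [m [Mm]] := clp _ (nbhsx_ballx p _ eC).
by rewrite -ball_normE /= normE ltcR => pm; exists m.
Qed.

Lemma closure_orthogonal M z p :
  (forall m, M m -> ip z m = 0) -> closure M p -> ip z p = 0.
Proof.
move=> zM clp; apply: Normc.eq0_normc; apply/eqP; rewrite eq_le normc_ge0 andbT.
apply: (@le0_of_le_mul _ _ `[z]) => [|e e0]; first exact: seminorm_ge0.
have [m Mm pm] := closure_seminorm clp e0.
have -> : ip z p = ip z (p - m) by rewrite (sipBr hs) (zM m)// subr0.
apply: le_trans (seminorm_sip_le hs _ _) _.
by rewrite ler_wpM2l ?seminorm_ge0// ltW.
Qed.

(** Subspaces may fail to be closed, as [range A] may, so projections land in the closure. *)
Definition subspace M := M 0 /\ forall a x y, M x -> M y -> M (a *: x + y).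

Lemma seminormZ (a : R[i]) x : `[a *: x] = Normc.normc a * `[x].
Proof. by apply: complexI; rewrite rmorphM/= -!normE normrZ. Qed.

Lemma parallelogram x y :
  `[x + y] ^+ 2 + `[x - y] ^+ 2 = 2 * `[x] ^+ 2 + 2 * `[y] ^+ 2.
Proof.
rewrite -[x in x + y]scale1r (addrC x) -scaleN1r !(sqr_seminormD hs).
rewrite !sqr_normcE (sip_conj hs x y); case: (ip x y) => u v /=; ring.
Qed.

(* [p] is the limit of the filter of near-minimizers [n] of [|x - n|] in [M].
   Perturbing such an [n] by multiples of [m] and using [sqr_normc_le_discriminant]
   bounds [<x - n, m>] by [e |m|] without ever comparing [|x - p|] to the infimum. *)
Lemma orthogonal_projection M x : subspace M ->
  exists2 p, closure M p & forall m, M m -> ip (x - p) m = 0.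
Proof.
move=> [M0 MP].
pose E := [set `[x - m] ^+ 2 | m in M]; pose d := inf E.
have infE : has_inf E.
  split; first by exists (`[x - 0] ^+ 2), 0.
  by exists 0 => _ [m _ <-]; exact: sqr_ge0.
have d_le m : M m -> d <= `[x - m] ^+ 2.
  by move=> Mm; apply: ge_inf; [case: infE|exists m].
have near_inf (e : R) : 0 < e -> exists2 m, M m & `[x - m] ^+ 2 < d + e.
  by move=> e0; have [_ [m Mm <-] me] := inf_adherent e0 infE; exists m.
pose F := filter_from [set e : R | 0 < e]
  (fun e => [set m | M m /\ `[x - m] ^+ 2 < d + e]).
have FF : ProperFilter F.
  apply: filter_from_proper => [|e /near_inf[m Mm me]]; last by exists m.
  apply: filter_from_filter => [|e1 e2 e1_0 e2_0]; first by exists 1 => /=.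
  exists (Num.min e1 e2); first by rewrite /= lt_min e1_0.
  move=> m [Mm me]; split; split=> //; apply: lt_le_trans me _;
    by rewrite lerD2l ge_min lexx ?orbT.
have FM (e : R) : 0 < e -> F [set m | M m /\ `[x - m] ^+ 2 < d + e] by exists e.
have /cauchy_cvgP/cvg_ex[p Fp] : cauchy F.
  apply: cauchy_exP => -[e e'] /[dup] ee; rewrite ltcE/= => /andP[/eqP e'0 e0].
  (* The midpoint of [m] and [n] lies in [M], so the parallelogram law gives
     [|m - n|^2 < 4 (d + e^2 / 4) - 4 d = e^2]. *)
  have e4 : 0 < e ^+ 2 / 4 by rewrite divr_gt0// exprn_gt0.
  have [n Mn xn] := near_inf _ e4; exists n.
  apply: filterS (FM _ e4) => m [Mm xm].
  rewrite -ball_normE /= normE e'0 ltcR -[_ < _](@ltr_pXn2r _ 2)// ?nnegrE ?seminorm_ge0 ?ltW//.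
  have Mmid : M (2^-1 *: (m + n)).
    by rewrite -[_ *: _]addr0; apply: (MP) => //; rewrite -[m]scale1r; exact: MP.
  have := d_le _ Mmid; have := parallelogram (x - m) (x - n).
  have -> : x - m - (x - n) = n - m by rewrite opprB addrC addrA subrK.
  have -> : x - m + (x - n) = 2 *: (x - 2^-1 *: (m + n)).
    by rewrite scalerBr scalerA divff// scale1r scaler_nat mulr2n addrACA -opprD.
  rewrite seminormZ exprMn (_ : Normc.normc 2 = 2); last first.
    by rewrite -[2]/(2%:R) -(rmorph_nat (real_complex R)) normc_real.
  lra.
exists p.
  move=> B /Fp FB; have [m [[Mm _] Bm]] := filter_ex (filterI (FM 1 ltr01) FB).
  by exists m.
move=> m Mm; apply: Normc.eq0_normc; apply/eqP; rewrite eq_le normc_ge0 andbT.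
(* One [e |m|] comes from near-minimality of [n], the other from [|p - n| < e]. *)
apply: (@le0_of_le_mul _ _ (2 * `[m])) => [|e e0]; first by rewrite mulr_ge0 ?seminorm_ge0.
have e2 : 0 < e ^+ 2 by rewrite exprn_gt0.
have eC : 0 < e%:C by rewrite ltcR.
have [n [[Mn xn]]] := filter_ex (filterI (FM _ e2) (Fp _ (nbhsx_ballx p _ eC))).
rewrite -ball_normE /= normE ltcR => pn.
have {}xn : Normc.normc (ip (x - n) m) <= e * `[m].
  rewrite -[_ <= _](@ler_pXn2r _ 2)// ?nnegrE ?normc_ge0 ?mulr_ge0 ?seminorm_ge0 ?(ltW e0)//.
  rewrite exprMn; apply: sqr_normc_le_discriminant => [|a]; first exact: sqr_ge0.
  have := sqr_seminormD hs a m (x - n).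
  have -> : a *: m + (x - n) = x - ((- a) *: m + n).
    by rewrite scaleNr opprD opprK addrCA.
  by have := d_le _ (MP (- a) _ _ Mm Mn); lra.
have -> : ip (x - p) m = ip (x - n) m - ip (p - n) m.
  by rewrite -(sipBl hs) opprB addrA subrK.
apply: le_trans (le_normcD _ _) _; rewrite normcN.
have := seminorm_sip_le hs (p - n) m.
have : `[p - n] * `[m] <= e * `[m] by rewrite ler_wpM2r ?seminorm_ge0 ?ltW.
lra.
Qed.

(** * Riesz representation and the Hilbert adjoint *)

Lemma ip_inj x y : (forall z, ip z x = ip z y) -> x = y.
Proof.
move=> xy; apply/eqP; rewrite -subr_eq0; apply/eqP/seminorm_eq0/eqP.
by rewrite -sqrf_eq0 sqr_seminorm// (sipBr hs) xy subrr.
Qed.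

(** Project some [x0] with [g x0 <> 0] on the kernel of [g]; by boundedness the projection stays in
    the kernel, so [g z <> 0] for the residual [z]. As [g z *: x - g x *: z] is in the kernel,
    orthogonality to [z] yields [g z <x, z> = g x <z, z>]. *)
Lemma riesz_representation (g : H -> R[i]) (K : R) : 0 <= K ->
  (forall a x y, g (a *: x + y) = a * g x + g y) ->
  (forall x, Normc.normc (g x) <= K * `[x]) -> exists z, forall x, g x = ip x z.
Proof.
move=> K0 gP gK.
have g0 : g 0 = 0.
  have := gP (-1) 0 0; rewrite scaler0 addr0 => ->; ring.
have gB x y : g (x - y) = g x - g y.
  by rewrite addrC -scaleN1r gP; ring.
have [/existsNP[x0 gx0]|/contrapT gE0] := pselect (~ forall x, g x = 0); last first.
  by exists 0 => x; rewrite (sip0r hs).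
pose M := [set x | g x = 0].
have sM : subspace M.
  by split=> // a x y; rewrite /M /= gP => -> ->; rewrite mulr0 addr0.
have [p clp orth] := orthogonal_projection x0 sM.
have gp : g p = 0.
  apply: Normc.eq0_normc; apply/eqP; rewrite eq_le normc_ge0 andbT.
  apply: (le0_of_le_mul K0) => e e0.
  have [m Mm pm] := closure_seminorm clp e0.
  rewrite -[g p]subr0 -[in X in g p - X]Mm -gB.
  by apply: le_trans (gK _) _; rewrite ler_wpM2l// ltW.
set z := x0 - p.
have gz : g z <> 0 by rewrite gB gp subr0.
have zz : ip z z != 0.
  apply/eqP => zz; apply: gz; rewrite (seminorm_eq0 (x := z)) //.
  by apply/eqP; rewrite -sqrf_eq0 sqr_seminorm// zz.
exists (conjc (g z / ip z z) *: z) => x.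
have /orth : M (g z *: x - g x *: z).
  by rewrite /M /= gB -[g z *: x]addr0 -[g x *: z]addr0 !gP !g0; ring.
rewrite (sip_conj hs) -/z => /(congr1 conjc); rewrite conjcK conjc0.
rewrite (sipBl hs) -[g z *: x]addr0 -[g x *: z]addr0 !(sipPl hs) !(sip0l hs) !addr0.
move/eqP; rewrite subr_eq0 => /eqP gzx.
rewrite -[_ *: z]addr0 (sipPr hs) (sip0r hs) addr0 conjcK.
by apply: (mulIf zz); rewrite -gzx; field.
Qed.

Lemma bounded_operatorI T (K : R) : linear T ->
  (forall x, `[T x] <= K * `[x]) -> bounded_operator T.
Proof.
by move=> Tlin TK; split=> //; exists K => x; rewrite !normE -rmorphM lecR.
Qed.

Lemma adjointP T : bounded_operator T ->
  bounded_operator (adjoint ip T) /\ forall x y, ip (T x) y = ip x (adjoint ip T y).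
Proof.
move=> bT; apply: (@getPex _ [set S | bounded_operator S /\ _]) => /=.
have [Tlin _] := bT; have [K K0 TK] := bounded_operator_seminorm bT.
have /choice[S TS] y : exists z, forall x, ip (T x) y = ip x z.
  apply: (@riesz_representation _ (K * `[y])) => [|a u v|x].
  - by rewrite mulr_ge0 ?(ltW K0) ?seminorm_ge0.
  - by rewrite Tlin (sipPl hs).
  apply: le_trans (seminorm_sip_le hs _ _) _.
  by rewrite mulrAC ler_wpM2r ?seminorm_ge0.
exists S; split=> [|x y]; last exact: TS.
apply: (@bounded_operatorI _ K) => [a x y|y].
  by apply: ip_inj => z; rewrite -TS !(sipPr hs) !TS.
(* Otherwise divide [|S y|^2 = <T (S y), y> <= K |S y| |y|] by [|S y|]. *)
have [->|Sy] := eqVneq `[S y] 0; first by rewrite mulr_ge0 ?(ltW K0) ?seminorm_ge0.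
rewrite -(@ler_pM2r _ `[S y]) ?lt_neqAle 1?eq_sym ?Sy ?seminorm_ge0//.
rewrite -expr2 -[leLHS]normc_real ?sqr_ge0// sqr_seminormC// -TS.
apply: le_trans (seminorm_sip_le hs _ _) _.
by rewrite mulrAC ler_wpM2r ?seminorm_ge0.
Qed.

(** * Positive operators and the reduced adjoint *)

Section ReducedAdjoint.
Variable A : H -> H.
Hypotheses (bA : bounded_operator A) (pA : positive_operator ip A).

(** Polarization: the quadratic form of [A] is real at [x + y] and at [i x + y], which fixes the
    imaginary and the real part respectively. *)
Lemma positive_operator_symmetric x y : ip (A x) y = ip x (A y).
Proof.
have [Alin _] := bA; rewrite (sip_conj hs (A y) x).
have im0 z : complex.Im (ip (A z) z) = 0 by exact: ger0_Im.
have e1 := im0 (1 *: x + y); have e2 := im0 (Complex 0 1 *: x + y).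
move: e1 e2; rewrite !Alin !(sipPl hs) !(sipPr hs) rmorph1.
have := im0 x; have := im0 y.
move: (ip (A x) x) (ip (A y) y) (ip (A x) y) (ip (A y) x).
move=> [a1 a2] [b1 b2] [c1 c2] [d1 d2] /= -> -> e1 e2.
by congr Complex; lra.
Qed.

Lemma semi_inner_product_ipA : semi_inner_product (ipA ip A).
Proof.
have [Alin _] := bA; split=> [a x y z|x y|x]; last exact: pA.
  by rewrite /ipA Alin (sipPl hs).
by rewrite /ipA positive_operator_symmetric (sip_conj hs).
Qed.

(* The reduced solution is the orthogonal projection onto [closure (range A)]
   of an arbitrary solution: the residual lies in the kernel of [A]. *)
Lemma sharpP T : A_adjointable ip A T ->
  bounded_operator (sharp ip A T)
  /\ forall x, A (sharp ip A T x) = adjoint ip T (A x).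
Proof.
move=> [_ [S [bS AS]]]; have [Alin _] := bA; have [Slin _] := bS.
suff [X [bX AX clX]] : exists X, [/\ bounded_operator X, A \o X = adjoint ip T \o A
    & range X `<=` closure (range A)].
  have [] := getPex (ex_intro (fun X => [/\ bounded_operator X,
    A \o X = adjoint ip T \o A & range X `<=` closure (range A)]) X (And3 bX AX clX)).
  by move=> bs As _; split=> // x; exact: (congr1 (@^~ x) As).
have sA : subspace (range A).
  split; first by exists 0 => //; exact: operator0.
  by move=> a _ _ [x _ <-] [y _ <-]; exists (a *: x + y) => //; exact: Alin.
have /choice[P /all_and2[clP orthP]] x : exists p, closure (range A) p
    /\ forall m, range A m -> ip (x - p) m = 0.
  by have [p clp orth] := orthogonal_projection x sA; exists p.
have orthcl x z : ip (x - P x) (P z) = 0.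
  exact: closure_orthogonal (orthP x) (clP z).
have AP x : A (P x) = A x.
  apply: ip_inj => z; rewrite -!positive_operator_symmetric.
  by apply/eqP; rewrite eq_sym -subr_eq0 -(sipBr hs) (sip_conj hs) orthP ?conjc0//.
(* The defect [w] is a combination of residuals, hence orthogonal to [range A] and its closure; it
   is also a combination of values of [P], hence orthogonal to itself. *)
have Plin : linear P.
  move=> a u v; apply/eqP; rewrite -subr_eq0; set w := _ - _.
  have worth m : range A m -> ip w m = 0.
    move=> Am; have -> : w = a *: (u - P u) + (v - P v) - (a *: u + v - P (a *: u + v)).
      by rewrite /w scalerBr addrACA -opprD opprB [RHS]addrC addrA subrK.
    by rewrite (sipBl hs) (sipPl hs) !orthP// mulr0 addr0 subr0.
  have wP z : ip w (P z) = 0 by exact: closure_orthogonal worth (clP z).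
  apply/eqP/seminorm_eq0/eqP; rewrite -sqrf_eq0 sqr_seminorm//.
  by rewrite [in X in ip _ X]/w (sipBr hs) (sipPr hs) !wP mulr0 addr0 subr0.
(* From [|P x|^2 = <x, P x>] and Cauchy-Schwarz. *)
have P1 x : `[P x] <= `[x].
  have [->|Px] := eqVneq `[P x] 0; first exact: seminorm_ge0.
  rewrite -(@ler_pM2r _ `[P x]) ?lt_neqAle 1?eq_sym ?Px ?seminorm_ge0//.
  rewrite -expr2 -[leLHS]normc_real ?sqr_ge0// sqr_seminormC//.
  have /eqP := orthcl x x; rewrite (sipBl hs) subr_eq0 => /eqP <-.
  exact: seminorm_sip_le.
have [K _ SK] := bounded_operator_seminorm bS.
exists (P \o S); split.
- apply: (@bounded_operatorI _ K) => [a x y|x] /=; first by rewrite Slin Plin.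
  exact: le_trans (P1 _) (SK _).
- by rewrite -AS; apply/funext => x /=.
- by move=> _ [x _ <-]; exact: clP.
Qed.

Lemma sharp_ipA T y z : A_adjointable ip A T ->
  ipA ip A (T y) z = ipA ip A y (sharp ip A T z).
Proof.
move=> hT; have [bT _] := hT; have [_ sE] := sharpP hT; have [_ TE] := adjointP bT.
by rewrite /ipA !positive_operator_symmetric sE TE.
Qed.

(** * Finiteness of the suprema over the [A]-unit sphere *)

Lemma normA_le : exists D : R, forall x, normA ip A x <= D * `[x].
Proof.
have [K K0 AK] := bounded_operator_seminorm bA.
exists (Num.sqrt K) => x; have hA := semi_inner_product_ipA.
rewrite -[normA _ _ _]/(seminorm (ipA ip A) x).
rewrite -[_ <= _](@ler_pXn2r _ 2)// ?nnegrE ?mulr_ge0 ?sqrtr_ge0//.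
rewrite exprMn [Num.sqrt K ^+ 2]sqr_sqrtr ?(ltW K0)//.
rewrite -[leLHS]normc_real ?sqr_ge0// (sqr_seminormC hA).
apply: le_trans (seminorm_sip_le hs _ _) _.
by rewrite expr2 mulrA ler_wpM2r ?seminorm_ge0.
Qed.

(** The iterates of [S \o T] at [x] grow at most like [(KS * KT)^k] times a multiple of [|x|]. That
    prefactor depends on [x] but the rate does not, so the bound is uniform on the sphere. *)
Lemma adjoint_pair_normA_bounded T S : bounded_operator T -> bounded_operator S ->
  (forall y z, ipA ip A (T y) z = ipA ip A y (S z)) ->
  exists c : R, forall x, A_sphere ip A x -> normA ip A (T x) <= c.
Proof.
move=> /bounded_operator_seminorm[KT KT0 TK] /bounded_operator_seminorm[KS KS0 SK] TS.
have [D DA] := normA_le; exists (Num.sqrt (KS * KT)) => x x1.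
apply: (adjoint_seminorm_le semi_inner_product_ipA (D := Num.max 0 D * `[x]) TS _ x1).
  exact: mulr_gt0.
move=> k; apply: le_trans (DA _) _.
apply: le_trans (_ : Num.max 0 D * `[iter k (S \o T) x] <= _).
  by rewrite ler_wpM2r ?seminorm_ge0// le_max lexx orbT.
rewrite -mulrA ler_wpM2l ?le_max ?lexx//.
elim: k => [|k IH]; first by rewrite expr0 mulr1.
apply: le_trans (SK _) _; rewrite exprS mulrCA -!mulrA ler_pM2l//.
by apply: le_trans (TK _) _; rewrite ler_pM2l// mulrC.
Qed.

Lemma normA_bounded T : A_adjointable ip A T ->
  exists c : R, forall x, A_sphere ip A x ->
    normA ip A (T x) <= c /\ normA ip A (sharp ip A T x) <= c.
Proof.
move=> hT; have [bT _] := hT; have [bS _] := sharpP hT.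
have TS y z := sharp_ipA y z hT.
have hA := semi_inner_product_ipA.
have [c cT] := adjoint_pair_normA_bounded bT bS TS.
have ST y z : ipA ip A (sharp ip A T y) z = ipA ip A y (T z).
  by rewrite (sip_conj hA) -TS -(sip_conj hA).
have [c' cS] := adjoint_pair_normA_bounded bS bT ST.
by exists (Num.max c c') => x x1; rewrite !le_max cT// cS// orbT.
Qed.

(** The bounds [c] and [d] make the set bounded above, so that its [sup] is a genuine supremum. *)
Lemma le_norm_Ae S T (c d : R) x :
  (forall y, A_sphere ip A y -> normA ip A (S y) <= c) ->
  (forall y, A_sphere ip A y -> normA ip A (T y) <= d) ->
  A_sphere ip A x ->
  Num.sqrt (normA ip A (S x) ^+ 2 + normA ip A (T x) ^+ 2) <= norm_Ae ip A S T.
Proof.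
move=> Sc Td x1; apply: ub_le_sup; last by exists x.
exists (Num.sqrt (c ^+ 2 + d ^+ 2)) => _ [y y1 <-]; apply: ler_wsqrtr.
by apply: lerD; rewrite lerXn2r ?nnegrE ?sqrtr_ge0 ?Sc ?Td//;
  apply: le_trans (sqrtr_ge0 _) _; [exact: Sc y y1 | exact: Td y y1].
Qed.

(** Moving one [T] across turns the form into [<T x, T^# x>_A], which Cauchy-Schwarz bounds by
    [c * c]. *)
Lemma le_w_A_sqr T x : A_adjointable ip A T -> A_sphere ip A x ->
  Normc.normc (ipA ip A (T (T x)) x) <= w_A ip A (T \o T).
Proof.
move=> hT x1; apply: ub_le_sup; last by exists x.
have [c cT] := normA_bounded hT; exists (c * c) => _ [y y1 <-] /=.
rewrite sharp_ipA//; apply: le_trans (seminorm_sip_le semi_inner_product_ipA _ _) _.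
by have [? ?] := cT _ y1; apply: ler_pM => //; exact: sqrtr_ge0.
Qed.

End ReducedAdjoint.

End HilbertSpace.

(** * Suprema of nonnegative functions and plane Cauchy-Schwarz *)

Section SupImage.
Variables (R : realType) (T : Type) (E : set T) (F : T -> R).
Hypothesis F_ge0 : forall x, 0 <= F x.

Lemma sup_image_ge0 : 0 <= sup [set F x | x in E].
Proof.
(* By convention [sup] is 0 on sets that are empty or unbounded above. *)
have [[[y [x Ex _]] ub]|/sup_out->//] := pselect (has_sup [set F x | x in E]).
by apply: le_trans (F_ge0 x) _; apply: ub_le_sup => //; exists x.
Qed.

Lemma sqr_sup_image_le (r : R) : 0 <= r ->
  (forall x, E x -> F x ^+ 2 <= r) -> sup [set F x | x in E] ^+ 2 <= r.
Proof.
move=> r0 Fr; have [->|/set0P[x Ex]] := eqVneq E set0.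
  by rewrite image_set0 sup0 expr0n.
rewrite -(sqr_sqrtr r0) ler_pXn2r ?nnegrE ?sqrtr_ge0 ?sup_image_ge0//.
apply: ge_sup => [|_ [y Ey <-]]; first by exists (F x), x.
by rewrite -(ger0_norm (F_ge0 y)) -sqrtr_sqr ler_wsqrtr// Fr.
Qed.

End SupImage.

Lemma cauchy_schwarz2 (R : rcfType) (a b c d : R) :
  a * c + b * d <= Num.sqrt (a ^+ 2 + b ^+ 2) * Num.sqrt (c ^+ 2 + d ^+ 2).
Proof.
apply: le_trans (ler_norm _) _.
rewrite -sqrtrM ?addr_ge0 ?sqr_ge0// -sqrtr_sqr ler_wsqrtr//.
(* Lagrange's identity: this square is the gap between the two sides squared. *)
have := sqr_ge0 (a * d - b * c); nra.
Qed.

(** * Pointwise estimate on the sphere and passage to suprema *)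

Unset Implicit Arguments.
Set Strict Implicit.

Theorem theorem2p15 (R : realType) (H : completeNormedModType R[i])
    (ip : inner_product H) (hip : hilbert_ip ip)
    (A : H -> H) (bA : bounded_operator A) (pA : positive_operator ip A)
    (A_neq0 : A <> (fun=> 0))
    (B C : H -> H) (hB : A_adjointable ip A B) (hC : A_adjointable ip A C)
    (alpha : R[i]) (alpha_neq0 : alpha != 0) :
  w_Ae ip A B C ^+ 2 <=
    (Num.max 1 (Normc.normc (1 - alpha)) * norm_Ae ip A B C
       * norm_Ae ip A (sharp ip A B) (sharp ip A C)
     + w_A ip A (B \o B) + w_A ip A (C \o C))
    / Normc.normc alpha.
Proof.
have a0 := normc_gt0 alpha_neq0.
set m := Num.max _ _.
have m0 : 0 <= m by rewrite le_max ler01.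
apply: sqr_sup_image_le => [x||e e1]; first exact: sqrtr_ge0.
  rewrite divr_ge0 ?normc_ge0// !addr_ge0// ?mulr_ge0//; apply: sup_image_ge0 => x;
    by [exact: sqrtr_ge0 | exact: normc_ge0].
rewrite sqr_sqrtr ?addr_ge0 ?sqr_ge0// ler_pdivlMr// mulrC mulrDr.
have hA := semi_inner_product_ipA hip bA pA.
have [b bB] := normA_bounded hip bA pA hB.
have [c cC] := normA_bounded hip bA pA hC.
have bz T y z := @sharp_ipA _ _ _ hip _ bA pA T y z.
have eB := buzano_adjoint_le hA alpha (fun y z => bz B y z hB) e1.
have eC := buzano_adjoint_le hA alpha (fun y z => bz C y z hC) e1.
(* Regroup the sum into [m (|B e| |B^# e| + |C e| |C^# e|)] and the terms in [B^2] and [C^2]. *)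
apply: le_trans (lerD eB eC) _; rewrite addrACA -mulrDr -addrA; apply: lerD; last first.
  by apply: lerD; exact: le_w_A_sqr.
rewrite -mulrA ler_wpM2l//; apply: le_trans (cauchy_schwarz2 _ _ _ _) _.
apply: ler_pM; rewrite ?sqrtr_ge0//.
  by apply: (le_norm_Ae (c := b) (d := c)) => // y y1; [case: (bB y y1)|case: (cC y y1)].
by apply: (le_norm_Ae (c := b) (d := c)) => // y y1; [case: (bB y y1)|case: (cC y y1)].
Qed.
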